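(* Let $U^\dagger, K^\dagger \in L^2(\mathbb{R}^2)$ with $U^\dagger\in S_1$, $K^\dagger\in S_2$, and let $f^\delta = K^\dagger * U^\dagger+n^\delta$ with $\|n^\delta\|_{L^2}\le\delta$ for some $\delta>0$. Let $(u_i,k_i)_{i\ge 0}$ be obtained from the multiscale hierarchical decomposition method with data $f^\delta$, i.e. $$(u_0,k_0)\in \operatorname*{arg\,min}_{u,k\in L^2(\mathbb{R}^2)} \Phi(k,u,f^\delta)+\lambda_0J_1(u)+\mu_0J_2(k),$$ and, for $n\in\mathbb{N}_0$, $$(u_{n+1},k_{n+1})\in \operatorname*{arg\,min}_{u,k\in L^2(\mathbb{R}^2)} \Phi(k+K_n,u+U_n,f^\delta)+\lambda_{n+1}J_1(u)+\mu_{n+1}J_2(k),$$ where $U_n=\sum_{i=0}^n u_i$ and $K_n=\sum_{i=0}^n k_i$ (these depend on $\delta$). Assume that $J_1$ and $J_2$ are minimal at $0$ and that there are $C_1,C_2\ge 1$ such that $J_1(v_1-v_2)\le C_1(J_1(v_1)+J_1(v_2))$ and $J_2(h_1-h_2)\le C_2(J_2(h_1)+J_2(h_2))$ for all $v_1,v_2,h_1,h_2\in L^2(\mathbb{R}^2)$. Assume additionally that $J_1(U^\dagger)<\infty$, $J_2(K^\dagger)<\infty$, and that, with $C=\max\{C_1,C_2\}$, $\lambda_{n-1}\ge 2C\lambda_n$ and $\mu_{n-1}\ge 2C\mu_n$ for all $n\in\mathbb{N}$. Then $\Phi(K_n,U_n,f^\delta)$ is decreasing (non-increasing) in $n$ and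 for all $n\in\mathbb{N}_0$ $$\Phi(K_n,U_n,f^\delta)\le \frac{2C\left(\lambda_0J_1(U^\dagger)+\mu_0J_2(K^\dagger)\right)}{n+1}+\delta^2.$$ Moreover, suppose such data $f^\delta$ and iterates are given for every $\delta>0$, and let $n^*(\delta)$ be the stopping index given by the discrepancy principle with a fixed $\tau>1$. If $(n^*(\delta))_{\delta>0}$ is unbounded as $\delta\to0$, then $\Phi(K_{n^*(\delta)},U_{n^*(\delta)},f^\delta)$ converges to zero as $\delta\to 0$.
   Context: $L^2(\mathbb{R}^2)$ is the space of real-valued square-integrable functions on $\mathbb{R}^2$, and $*$ is convolution. $J_1,J_2:L^2(\mathbb{R}^2)\to\mathbb{R}\cup\{\infty\}$ are proper, lower semicontinuous, convex and non-negative functionals. $(\lambda_n)_{n\in\mathbb{N}_0}$ and $(\mu_n)_{n\in\mathbb{N}_0}$ are decreasing sequences of positive real numbers (independent of $\delta$). $S_1,S_2\subseteq L^2(\mathbb{R}^2)$ are convex sets encoding constraints on image and kernel, respectively. The data fidelity is $$\Phi(K,U,g)=\|g-K*U\|_{L^2}^2+\delta_{S_1}(U)+\delta_{S_2}(K),$$ where $\delta_S(z)=0$ if $z\in S$ and $\delta_S(z)=\infty$ otherwise (and $\|w\|_{L^2}=\infty$ if $w\notin L^2$). The minimizers in the iteration are assumed to exist; any choice of minimizers is allowed. Discrepancy principle: for fixed $\tau>1$, $$n^*(\delta)=\max\{n\in\mathbb{N}_0:\ \Phi(K_n,U_n,f^\delta)>\tau\delta^2\}+1,$$ with the convention $n^*(\delta)=0$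 if this set is empty. *)

(* Defs.v *)
From HB Require Import structures.
From mathcomp Require Import all_boot all_order all_algebra.
From mathcomp Require Import all_classical all_reals all_analysis.
From mathcomp Require Import measurable_realfun ess_sup_inf.
Import Order.TTheory GRing.Theory Num.Theory.
Import numFieldNormedType.Exports.

Set Implicit Arguments.
Unset Strict Implicit.
Unset Printing Implicit Defensive.

Local Open Scope classical_set_scope.
Local Open Scope ring_scope.

(* LspaceType, the library's space of a.e.-classes of p-integrable functions,
   carries no algebraic structure.  It is made here into a normed module, with
   the operations of LfunType on representatives and the Lp-norm. *)
Section Lspace_normedModType.
Context d (T : measurableType d) (R : realType).
Variables (mu : {measure set T -> \bar R}) (p : \bar R) (p1 : (1 <= p)%E).
Local Notation Lf := (LfunType mu p1).
Local Notation Ls := (LspaceType mu p1).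
Local Notation Q := {mfun_ mu, T >-> measurableTypeR R}.

Lemma ae_eq_Lnorm (f g : T -> R) :
  measurable_fun [set: T] f -> measurable_fun [set: T] g ->
  f = g %[ae mu] -> ('N[mu]_p[EFin \o f] = 'N[mu]_p[EFin \o g])%E.
Proof.
have mN (h : T -> R) (r : R) : measurable_fun [set: T] h ->
    measurable_fun [set: T] (fun x => `|(EFin \o h) x| `^ r)%E.
  move=> mh; apply: (@measurableT_comp _ _ _ _ _ _ (fun x => x `^ r)%E).
    exact: measurable_poweR.
  by apply: measurableT_comp => //; exact/measurable_EFinP.
move=> mf mg fg; rewrite unlock /Lnorm; case: p p1 => [r _| _|//].
  congr (_ `^ _)%E; apply: ge0_ae_eq_integral => //.
  - exact: mN.
  - exact: mN.
  - by move=> x _; exact: poweR_ge0.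
  - by move=> x _; exact: poweR_ge0.
  - by apply: filterS fg => x /= /[apply] ->.
case: ifPn => // _; apply: eq_ess_sup.
by apply: filterS fg => x /= /(_ I) ->.
Qed.

Section Lspace_pi.
Local Open Scope quotient_scope.
Variable f : Lf.
Let g : T -> measurableTypeR R := f.
Let mg : measurable_fun [set: T] g.
Proof. exact: (@measurable_funPT _ _ _ _ f). Qed.
HB.instance Definition _ := isMeasurableFun.Build _ _ T (measurableTypeR R) g mg.
Let c : Q := \pi_Q g.

Let pi_ae : (repr c : T -> R) = f %[ae mu].
Proof. by apply/asboolP; have /eqmodP := reprK c. Qed.

Let c_fin : finite_norm mu p c.
Proof.
rewrite /finite_norm (@ae_eq_Lnorm _ f _ _ pi_ae)//; first exact: Lfunction_finite.
exact: (@measurable_funPT _ _ _ _ (repr c)).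
Qed.

HB.instance Definition _ := isFinLebesgue.Build d T R mu p p1 c c_fin.

Definition Lspace_pi : Ls := c.

End Lspace_pi.

Section Lspace_repr.
Variable u : Ls.
Let f : T -> R := repr (u : Q).
Let mf : measurable_fun [set: T] f.
Proof. exact: (@measurable_funPT _ _ _ _ (repr (u : Q))). Qed.
HB.instance Definition _ := isMeasurableFun.Build _ _ T R f mf.
HB.instance Definition _ :=
  isLfunction.Build d T R mu p p1 f (@Lebesgue_finite _ _ _ _ _ _ u).
Definition Lspace_repr : Lf := f.
End Lspace_repr.

Lemma Lspace_sort_inj (u v : Ls) : u = v :> Q -> u = v.
Proof.
case: u => u [[cu]]; case: v => v [[cv]] /= uv.
by subst v; rewrite (Prop_irrelevance cu cv).
Qed.

Lemma Lspace_reprK : cancel Lspace_repr Lspace_pi.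
Proof.
move=> u; apply: Lspace_sort_inj => /=; rewrite -[RHS]reprK.
by congr (\pi_Q%qT _); apply/val_inj/funext => x.
Qed.

Lemma Lspace_piP (f g : Lf) : f = g %[ae mu] -> Lspace_pi f = Lspace_pi g.
Proof.
by move=> fg; apply: Lspace_sort_inj; apply/eqmodP/asboolP.
Qed.

Lemma Lspace_piK (f : Lf) : Lspace_repr (Lspace_pi f) = f %[ae mu].
Proof.
apply/asboolP; have /eqmodP := reprK (Lspace_pi f : Q); exact.
Qed.

Definition Lspace_add (u v : Ls) := Lspace_pi (Lspace_repr u + Lspace_repr v).
Definition Lspace_opp (u : Ls) := Lspace_pi (- Lspace_repr u).
Definition Lspace_scale (a : R) (u : Ls) := Lspace_pi (a *: Lspace_repr u).

Lemma Lspace_ind (P : Ls -> Prop) : (forall f, P (Lspace_pi f)) -> forall u, P u.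
Proof. by move=> Pf u; rewrite -[u]Lspace_reprK. Qed.

Let addE f g : Lspace_add (Lspace_pi f) (Lspace_pi g) = Lspace_pi (f + g).
Proof.
apply: Lspace_piP; apply: filterS2 (Lspace_piK f) (Lspace_piK g) => x /= fx gx _.
by rewrite !fctE fx// gx.
Qed.

Let oppE f : Lspace_opp (Lspace_pi f) = Lspace_pi (- f).
Proof.
by apply: Lspace_piP; apply: filterS (Lspace_piK f) => x /= fx _; rewrite !fctE fx.
Qed.

Let scaleE a f : Lspace_scale a (Lspace_pi f) = Lspace_pi (a *: f).
Proof.
by apply: Lspace_piP; apply: filterS (Lspace_piK f) => x /= fx _; rewrite !fctE fx.
Qed.

Let addA : associative Lspace_add.
Proof.
elim/Lspace_ind=> f; elim/Lspace_ind=> g; elim/Lspace_ind=> h.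
by rewrite !addE addrA.
Qed.

Let addC : commutative Lspace_add.
Proof. by elim/Lspace_ind=> f; elim/Lspace_ind=> g; rewrite !addE addrC. Qed.

Let add0 : left_id (Lspace_pi 0) Lspace_add.
Proof. by elim/Lspace_ind=> f; rewrite addE add0r. Qed.

Let addN : left_inverse (Lspace_pi 0) Lspace_opp Lspace_add.
Proof. by elim/Lspace_ind=> f; rewrite oppE addE addNr. Qed.

HB.instance Definition _ := gen_eqMixin Ls.
HB.instance Definition _ := gen_choiceMixin Ls.
HB.instance Definition _ := GRing.isZmodule.Build Ls addA addC add0 addN.

Let scaleA a b u : Lspace_scale a (Lspace_scale b u) = Lspace_scale (a * b) u.
Proof. by elim/Lspace_ind: u => f; rewrite !scaleE scalerA. Qed.

Let scale1 : left_id 1 Lspace_scale.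
Proof. by elim/Lspace_ind=> f; rewrite scaleE scale1r. Qed.

Let scaleDr : right_distributive Lspace_scale +%R.
Proof.
move=> a; elim/Lspace_ind=> f; elim/Lspace_ind=> g.
by rewrite [_ + _]addE !scaleE [RHS]addE scalerDr.
Qed.

Let scaleDl u : {morph Lspace_scale^~ u : a b / a + b}.
Proof.
by elim/Lspace_ind: u => f a b; rewrite !scaleE [RHS]addE scalerDl.
Qed.

HB.instance Definition _ :=
  GRing.Zmodule_isLmodule.Build R Ls scaleA scale1 scaleDr scaleDl.

Definition Lspace_norm (u : Ls) : R := fine 'N[mu]_p[EFin \o Lspace_repr u]%E.

Let norm_pi f : Lspace_norm (Lspace_pi f) = fine 'N[mu]_p[EFin \o f]%E.
Proof. by congr fine; apply: ae_eq_Lnorm (Lspace_piK f). Qed.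

Let normD u v : Lspace_norm (u + v) <= Lspace_norm u + Lspace_norm v.
Proof.
elim/Lspace_ind: u => f; elim/Lspace_ind: v => g.
by rewrite [_ + _ in leLHS]addE !norm_pi ler_LnormD.
Qed.

Let normZ a u : Lspace_norm (a *: u) = `|a| * Lspace_norm u.
Proof.
elim/Lspace_ind: u => f; rewrite [_ *: _]scaleE !norm_pi.
by rewrite [X in fine X]LnormZ -finite_norm_fine -EFinM.
Qed.

Let norm_eq0 u : Lspace_norm u = 0 -> u = 0.
Proof.
elim/Lspace_ind: u => f; rewrite norm_pi => /fine_Lnormr_eq0 f0.
exact: Lspace_piP.
Qed.

HB.instance Definition _ :=
  @Lmodule_isNormed.Build R Ls Lspace_norm normD normZ norm_eq0.

Lemma Lspace_normE (u : Ls) :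
  (`|u|%:E = 'N[mu]_p[EFin \o Lspace_repr u])%E.
Proof. exact: finite_norm_fine. Qed.

End Lspace_normedModType.

Definition plane (R : realType) : measurableType _ :=
  (measurableTypeR R * measurableTypeR R)%type.

Definition lebesgue2 {R : realType} : {measure set (plane R) -> \bar R} :=
  (@lebesgue_measure R \x @lebesgue_measure R)%E.

Definition L2 (R : realType) : normedModType R :=
  LspaceType (@lebesgue2 R) (lee1n 2).

Section multiscale.
Variable R : realType.

(* The value at x depends only on the classes of K and U, and the integrand is
   integrable by Cauchy-Schwarz. *)
Definition convolution (K U : L2 R) : plane R -> R := fun x =>
  \int[lebesgue2]_y (Lspace_repr K (x.1 - y.1, x.2 - y.2) * Lspace_repr U y).

Local Open Scope ereal_scope.

Definition L2norm (w : plane R -> R) : \bar R :=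
  if w \in Lfun lebesgue2 2%:R%:E then 'N[lebesgue2]_2%:R%:E[EFin \o w] else +oo.

Definition set_indicator (S : set (L2 R)) (z : L2 R) : \bar R :=
  if z \in S then 0 else +oo.

Definition Phi (S1 S2 : set (L2 R)) (K U : L2 R) (g : plane R -> R) : \bar R :=
  L2norm (g \- convolution K U)%R ^+ 2 + set_indicator S1 U + set_indicator S2 K.

Definition proper_functional (J : L2 R -> \bar R) : Prop :=
  (forall v, J v != -oo) /\ exists v, J v < +oo.

Definition convex_ereal (J : L2 R -> \bar R) : Prop :=
  forall (x y : L2 R) (t : R), (0 <= t <= 1)%R ->
    J (t *: x + (1 - t) *: y)%R <= t%:E * J x + (1 - t)%:E * J y.

Definition regularizer (J : L2 R -> \bar R) : Prop :=
  [/\ proper_functional J, lower_semicontinuous J, convex_ereal J & forall v, 0 <= J v].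

Definition argmin (F : L2 R -> L2 R -> \bar R) : set (L2 R * L2 R) :=
  [set p | forall u k, F p.1 p.2 <= F u k].

Definition partial_sum (u : nat -> L2 R) (n : nat) : L2 R := (\sum_(i < n.+1) u i)%R.

Definition mhdm (J1 J2 : L2 R -> \bar R) (S1 S2 : set (L2 R))
    (lam mu : nat -> R) (f : plane R -> R) (u k : nat -> L2 R) : Prop :=
  argmin (fun v h => Phi S1 S2 h v f + (lam 0%N)%:E * J1 v + (mu 0%N)%:E * J2 h)
    (u 0%N, k 0%N) /\
  forall n, argmin (fun v h =>
      Phi S1 S2 (h + partial_sum k n)%R (v + partial_sum u n)%R f
        + (lam n.+1)%:E * J1 v + (mu n.+1)%:E * J2 h)
    (u n.+1, k n.+1).

(* The maximum is taken to be 0 when it does not exist. *)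
Definition max_nat (A : set nat) : nat := xget 0%N [set n | A n /\ ubound A n].

Definition stopping_index (phi : nat -> \bar R) (tau delta : R) : nat :=
  let A := [set n | (tau * delta ^+ 2)%:E < phi n] in
  if A == set0 then 0%N else (max_nat A).+1.

(* Boundedness near 0 only: values at delta away from 0 do not matter. *)
Definition unbounded_at0 (n : R -> nat) : Prop :=
  ~ exists N, \forall delta \near 0^'+, (n delta <= N)%N.

End multiscale.

(* Main.v *)
(* Write x_n = lam_n J1(Ud - U_{n-1}) + mu_n J2(Kd - K_{n-1}) and
   y_n = lam_n J1(u_n) + mu_n J2(k_n).  Comparing (u_n, k_n) with (0, 0) gives the
   monotonicity; comparing it with (Ud - U_{n-1}, Kd - K_{n-1}) gives
   Phi_n + y_n <= delta^2 + x_n.  The rate on lam and mu absorbs the constant of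
   the quasi-triangle inequality, so that 2 x_{n+1} <= x_n + y_n, whence
   Phi_n - delta^2 <= 2 (x_n - x_{n+1}) telescopes.
   As the bound eventually falls below tau delta^2, the discrepancy principle stops
   at a genuine index, where Phi <= tau delta^2. *)
Require Import Defs.
From mathcomp Require Import all_boot all_order all_algebra.
From mathcomp Require Import all_classical all_reals all_analysis.
From mathcomp Require Import lra.
Import Order.TTheory GRing.Theory Num.Theory.
Import numFieldNormedType.Exports.

Local Open Scope classical_set_scope.
Local Open Scope ring_scope.

Lemma telescoped_bound (R : realFieldType) (p x y : nat -> R) (d : R) :
  (forall n, p n + y n <= d + x n) ->
  (forall n, 2 * x n.+1 <= x n + y n) ->
  (forall n, 0 <= x n) ->
  (forall n, p n.+1 <= p n) ->
  forall n, p n <= 2 * x 0%N / n.+1%:R + d.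
Proof.
move=> py xy x0 pdecr n.
have sum_le m : \sum_(i < m) p i + 2 * x m <= 2 * x 0%N + m%:R * d.
  elim: m => [|m IH]; first by rewrite big_ord0; lra.
  rewrite big_ord_recr /= -natr1; move: (py m) (xy m); lra.
(* A nonincreasing sequence has its last value below its average; dividing the telescoped sum by
   [n.+1] then gives the rate. *)
have p_le : n.+1%:R * p n <= \sum_(i < n.+1) p i.
  rewrite mulr_natl -[in leLHS](card_ord n.+1) -sumr_const; apply: ler_sum => i _.
  by have/nonincreasing_seqP := pdecr; apply; rewrite -ltnS.
rewrite -lerBlDr ler_pdivlMr ?ltr0n//.
move: (sum_le n.+1) p_le (x0 n.+1); lra.
Qed.

(** Finiteness propagates from [x 0]: the first inequality passes it from [x n] to [p n] and [y n],
    the second from [x n] and [y n] to [x n.+1]. All three sequences are thus real-valued and the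
    real case applies. *)
Lemma ereal_telescoped_bound (R : realType) (p x y : nat -> \bar R) (d : R) :
  (forall n, 0 <= p n)%E -> (forall n, 0 <= x n)%E -> (forall n, 0 <= y n)%E ->
  (x 0%N < +oo)%E ->
  (forall n, p n + y n <= d%:E + x n)%E ->
  (forall n, 2%:E * x n.+1 <= x n + y n)%E ->
  (forall n, p n.+1 <= p n)%E ->
  forall n, (p n <= 2%:E * x 0%N * (n.+1%:R^-1)%:E + d%:E)%E.
Proof.
move=> p0 x0 y0 x00 py xy pdecr.
have pyfin n : x n \is a fin_num -> p n \is a fin_num /\ y n \is a fin_num.
  move=> xn; have lt : (p n + y n < +oo)%E.
    by apply: le_lt_trans (py n) _; rewrite ltey_eq fin_numD xn.
  rewrite !ge0_fin_numE//; split; apply: le_lt_trans lt.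
    by rewrite leeDl.
  by rewrite leeDr.
have xfin n : x n \is a fin_num.
  elim: n => [|n IH]; first by rewrite ge0_fin_numE.
  have [_ yn] := pyfin n IH; rewrite ge0_fin_numE//.
  have : (2%:E * x n.+1 < +oo)%E.
    by apply: le_lt_trans (xy n) _; rewrite ltey_eq fin_numD IH yn.
  by case: (x n.+1) => [r||]; rewrite ?ltry ?ltNyr ?gt0_muley ?lte_fin ?ltr0n.
have pE n : p n = (fine (p n))%:E by rewrite fineK//; case: (pyfin n (xfin n)).
have yE n : y n = (fine (y n))%:E by rewrite fineK//; case: (pyfin n (xfin n)).
have xE n : x n = (fine (x n))%:E by rewrite fineK.
move=> n; rewrite pE xE -!EFinM -EFinD lee_fin.
apply: (@telescoped_bound _ (fine \o p) (fine \o x) (fine \o y)) => {}n /=.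
- by rewrite -lee_fin !EFinD -pE -yE -xE.
- by rewrite -lee_fin EFinD EFinM -yE -!xE.
- by rewrite fine_ge0.
- by rewrite -lee_fin -!pE.
Qed.

Lemma Phi_ge0 (R : realType) (S1 S2 : set (L2 R)) K U g : (0 <= Phi S1 S2 K U g)%E.
Proof.
have ind0 S (z : L2 R) : (0 <= set_indicator S z)%E.
  by rewrite /set_indicator; case: ifP.
by rewrite /Phi !adde_ge0// sqre_ge0.
Qed.

(** At the exact pair both constraint indicators vanish and the residual is pointwise the chosen
    representative of the noise. This is the source of the [delta ^+ 2] in the rate. *)
Lemma Phi_exact_le (R : realType) (S1 S2 : set (L2 R)) (K U noise : L2 R)
    (f : plane R -> R) (delta : R) :
  S1 U -> S2 K -> `|noise| <= delta ->
  f =1 convolution K U \+ Lspace_repr noise ->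
  (Phi S1 S2 K U f <= (delta ^+ 2)%:E)%E.
Proof.
move=> S1U S2K noise_le fE.
have -> : f = convolution K U \+ Lspace_repr noise by exact/funext.
rewrite /Phi /set_indicator !mem_set// !adde0.
have -> : (convolution K U \+ Lspace_repr noise) \- convolution K U = Lspace_repr noise.
  by apply/funext => x /=; rewrite addrC addKr.
rewrite /L2norm ifT; last exact: LfunP.
rewrite -Lspace_normE -EFin_expe lee_fin.
by apply: lerXn2r; rewrite // nnegrE// (le_trans _ noise_le).
Qed.

Lemma partial_sumE (R : realType) (u : nat -> L2 R) n :
  partial_sum u n = u n + \sum_(i < n) u i.
Proof. by rewrite /partial_sum big_ord_recr addrC. Qed.

(** With the empty sum as the state before step 0, the initial minimization and the recursive ones
    take the same form, so later arguments need no case split. *)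
Lemma mhdm_argmin (R : realType) (J1 J2 : L2 R -> \bar R) (S1 S2 : set (L2 R))
    (lam mu : nat -> R) (f : plane R -> R) (u k : nat -> L2 R) :
  mhdm J1 J2 S1 S2 lam mu f u k ->
  forall n v h,
    (Phi S1 S2 (partial_sum k n) (partial_sum u n) f
       + ((lam n)%:E * J1 (u n) + (mu n)%:E * J2 (k n))
     <= Phi S1 S2 (h + \sum_(i < n) k i)%R (v + \sum_(i < n) u i)%R f
       + ((lam n)%:E * J1 v + (mu n)%:E * J2 h))%E.
Proof.
move=> [min0 minS] [|n] v h; rewrite !partial_sumE.
  by rewrite !big_ord0 !addr0 !addeA; exact: min0.
by rewrite !addeA; exact: minS.
Qed.

Lemma mhdm_decreasing (R : realType) (J1 J2 : L2 R -> \bar R)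
    (S1 S2 : set (L2 R)) (lam mu : nat -> R) (f : plane R -> R)
    (u k : nat -> L2 R) :
  (forall n, 0 <= lam n) -> (forall n, 0 <= mu n) ->
  J1 0 \is a fin_num -> J2 0 \is a fin_num ->
  (forall v, (J1 0%R <= J1 v)%E) -> (forall h, (J2 0%R <= J2 h)%E) ->
  mhdm J1 J2 S1 S2 lam mu f u k ->
  forall n, (Phi S1 S2 (partial_sum k n.+1) (partial_sum u n.+1) f
             <= Phi S1 S2 (partial_sum k n) (partial_sum u n) f)%E.
Proof.
move=> lam0 mu0 J1fin J2fin J1min J2min umin n.
(* [J1 0] and [J2 0] may be positive. The penalty at zero is added to both sides, bounds the penalty
   of the new increments from below, and cancels because it is finite. *)
set r := ((lam n.+1)%:E * J1 0%R + (mu n.+1)%:E * J2 0%R)%E.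
have rfin : r \is a fin_num by rewrite fin_numD !fin_numM.
rewrite -(leeD2rE _ _ rfin).
have := mhdm_argmin _ _ _ _ _ _ _ _ _ _ umin n.+1 0 0.
rewrite !add0r; apply: le_trans; apply: leeD => //.
by apply: leeD; apply: lee_wpmul2l; rewrite ?lee_fin.
Qed.

(** One functional's share of [2 x_{n+1} <= x_n + y_n]: [v1] is the error before a step, [v2] the
    increment, [v1 - v2] the error after it. The decay from [c] to [c'] pays for both the factor 2
    and the quasi-triangle constant. *)
Lemma penalty_halving (R : realType) (J : L2 R -> \bar R) (C0 C c c' : R) v1 v2 :
  (forall v, 0 <= J v)%E ->
  (J (v1 - v2)%R <= C0%:E * (J v1 + J v2))%E ->
  C0 <= C -> 0 <= c' -> 2 * C * c' <= c ->
  (2%:E * (c'%:E * J (v1 - v2)%R) <= c%:E * J v1 + c%:E * J v2)%E.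
Proof.
move=> J0 Jsub C0C c'0 cc'.
rewrite -ge0_muleDr//; apply: (@le_trans _ _ ((2 * C * c')%:E * (J v1 + J v2))%E); last first.
  by apply: lee_wpmul2r; rewrite ?lee_fin// adde_ge0.
rewrite muleA -EFinM (_ : 2 * C * c' = 2 * c' * C); last by rewrite mulrAC.
rewrite [(2 * c' * C)%:E]EFinM -[leRHS]muleA.
apply: lee_wpmul2l; first by rewrite lee_fin mulr_ge0.
apply: le_trans Jsub _; apply: lee_wpmul2r; rewrite ?lee_fin//.
by rewrite adde_ge0.
Qed.

Lemma mhdm_rate (R : realType) (J1 J2 : L2 R -> \bar R)
    (S1 S2 : set (L2 R)) (lam mu : nat -> R) (Ud Kd noise : L2 R)
    (C1 C2 C delta : R) (f : plane R -> R) (u k : nat -> L2 R) :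
  (forall n, 0 <= lam n) -> (forall n, 0 <= mu n) ->
  (forall v, 0 <= J1 v)%E -> (forall h, 0 <= J2 h)%E ->
  (forall v, (J1 0%R <= J1 v)%E) -> (forall h, (J2 0%R <= J2 h)%E) ->
  (forall v1 v2 : L2 R, (J1 (v1 - v2)%R <= C1%:E * (J1 v1 + J1 v2))%E) ->
  (forall h1 h2 : L2 R, (J2 (h1 - h2)%R <= C2%:E * (J2 h1 + J2 h2))%E) ->
  C1 <= C -> C2 <= C ->
  (J1 Ud < +oo)%E -> (J2 Kd < +oo)%E ->
  (forall n, 2 * C * lam n.+1 <= lam n) ->
  (forall n, 2 * C * mu n.+1 <= mu n) ->
  S1 Ud -> S2 Kd ->
  `|noise| <= delta -> f =1 convolution Kd Ud \+ Lspace_repr noise ->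
  mhdm J1 J2 S1 S2 lam mu f u k ->
  forall n, (Phi S1 S2 (partial_sum k n) (partial_sum u n) f
    <= 2%:E * ((lam 0%N)%:E * J1 Ud + (mu 0%N)%:E * J2 Kd) * (n.+1%:R^-1)%:E
       + (delta ^+ 2)%:E)%E.
Proof.
move=> lam0 mu0 J1ge0 J2ge0 J1min J2min J1sub J2sub C1C C2C J1Ud J2Kd lamr mur
  S1Ud S2Kd noise_le fE umin.
have J1fin : J1 0 \is a fin_num by rewrite ge0_fin_numE// (le_lt_trans (J1min Ud)).
have J2fin : J2 0 \is a fin_num by rewrite ge0_fin_numE// (le_lt_trans (J2min Kd)).
pose pen n v h := ((lam n)%:E * J1 v + (mu n)%:E * J2 h)%E.
have pen_ge0 n v h : (0 <= pen n v h)%E.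
  by rewrite adde_ge0// mule_ge0// lee_fin.
(* The sums run over [i < n], so this is the penalty of the error before step [n]; at [n = 0] it is
   the penalty of the exact pair itself. *)
pose x n := pen n (Ud - \sum_(i < n) u i) (Kd - \sum_(i < n) k i).
have x0E : x 0%N = pen 0%N Ud Kd by rewrite /x !big_ord0 !subr0.
rewrite -[(_ * J1 Ud + _)%E]x0E.
apply: (ereal_telescoped_bound _ _ x (fun n => pen n (u n) (k n))) => //.
- by move=> n; exact: Phi_ge0.
- by move=> n; exact: pen_ge0.
- by rewrite x0E ltey_eq fin_numD !fin_numM// ge0_fin_numE.
(* The competitor is the remaining error: added to the current sums it restores exactly
   [(Ud, Kd)]. *)
- move=> n; apply: le_trans (mhdm_argmin _ _ _ _ _ _ _ _ _ _ umin n
    (Ud - \sum_(i < n) u i) (Kd - \sum_(i < n) k i)) _.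
  by rewrite !subrK; apply: leeD => //; exact: Phi_exact_le fE.
- move=> n; rewrite /x /pen ge0_muleDr ?mule_ge0 ?lee_fin//.
  (* Regroup by functional and write each new error as the old error minus the new increment. *)
  rewrite addeACA !big_ord_recr/= !opprD ![(_ + (_ - _))%R]addrA.
  by apply: leeD; [apply: (penalty_halving _ _ C1 C)|apply: (penalty_halving _ _ C2 C)].
- exact: (mhdm_decreasing _ J1 J2 S1 S2 lam mu).
Qed.

(** The indices above the threshold all lie below [N], so if there are any, a genuine maximum exists
    and its successor is no longer among them. If there are none, index 0 already meets the
    threshold. *)
Lemma stopping_index_le (R : realType) (phi : nat -> \bar R) (tau delta : R) N :
  (forall n, (N <= n)%N -> (phi n <= (tau * delta ^+ 2)%:E)%E) ->
  (phi (stopping_index phi tau delta) <= (tau * delta ^+ 2)%:E)%E.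
Proof.
move=> phiN; rewrite /stopping_index.
set A := [set n | _]; case: eqP => [A0|/eqP/set0P A_neq0].
  by rewrite leNgt; apply/negP => ?; suff : A 0%N by rewrite A0.
have exA : exists n, `[< A n >] by have [n An] := A_neq0; exists n; exact/asboolP.
have leAN n : `[< A n >] -> (n <= N)%N.
  move=> /asboolP An; rewrite leqNgt; apply/negP => /ltnW /phiN.
  by rewrite leNgt An.
(* This ensures that [max_nat] returns the maximum and not its default value 0. *)
have exmax : exists n, A n /\ ubound A n.
  have [m /asboolP Am maxm] := ex_maxnP exA leAN.
  by exists m; split => // i /asboolP; exact: maxm.
have [_ maxA] : A (max_nat A) /\ ubound A (max_nat A).
  by have [m Pm] := exmax; exact: (xgetPex 0%N exmax).
rewrite leNgt; apply/negP => /(maxA _).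
by rewrite leEnat ltnn.
Qed.

Theorem theorem2p2 (R : realType)
  (J1 J2 : L2 R -> \bar R) (S1 S2 : set (L2 R)) (lam mu : nat -> R)
  (Ud Kd : L2 R) (C1 C2 : R)
  (C := Num.max C1 C2)
  (hJ1 : regularizer J1) (hJ2 : regularizer J2)
  (hS1 : convex_set S1) (hS2 : convex_set S2)
  (lam_gt0 : forall n, 0 < lam n) (mu_gt0 : forall n, 0 < mu n)
  (lam_decr : nonincreasing_seq lam) (mu_decr : nonincreasing_seq mu)
  (hUd : S1 Ud) (hKd : S2 Kd)
  (J1_min0 : forall v, (J1 0%R <= J1 v)%E) (J2_min0 : forall h, (J2 0%R <= J2 h)%E)
  (hC1 : 1 <= C1) (hC2 : 1 <= C2)
  (J1_sub : forall v1 v2 : L2 R, (J1 (v1 - v2)%R <= C1%:E * (J1 v1 + J1 v2))%E)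
  (J2_sub : forall h1 h2 : L2 R, (J2 (h1 - h2)%R <= C2%:E * (J2 h1 + J2 h2))%E)
  (J1Ud : (J1 Ud < +oo)%E) (J2Kd : (J2 Kd < +oo)%E)
  (lam_rate : forall n, 2 * C * lam n.+1 <= lam n)
  (mu_rate : forall n, 2 * C * mu n.+1 <= mu n) :
  (forall (delta : R) (noise : L2 R) (f : plane R -> R) (u k : nat -> L2 R),
     0 < delta -> `|noise| <= delta -> f =1 convolution Kd Ud \+ Lspace_repr noise ->
     mhdm J1 J2 S1 S2 lam mu f u k ->
     (forall n, Phi S1 S2 (partial_sum k n.+1) (partial_sum u n.+1) f
                <= Phi S1 S2 (partial_sum k n) (partial_sum u n) f)%E /\
     (forall n, Phi S1 S2 (partial_sum k n) (partial_sum u n) f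
        <= (2 * C)%R%:E * ((lam 0%N)%:E * J1 Ud + (mu 0%N)%:E * J2 Kd)
             * (n.+1%:R^-1)%:E + (delta ^+ 2)%R%:E)%E)
  /\
  (forall (tau : R) (noise : R -> L2 R) (f : R -> plane R -> R)
     (u k : R -> nat -> L2 R) (phi := fun delta n =>
        Phi S1 S2 (partial_sum (k delta) n) (partial_sum (u delta) n) (f delta))
     (nstar := fun delta => stopping_index (phi delta) tau delta),
     1 < tau ->
     (forall delta, 0 < delta ->
        [/\ `|noise delta| <= delta,
            f delta =1 convolution Kd Ud \+ Lspace_repr (noise delta) &
            mhdm J1 J2 S1 S2 lam mu (f delta) (u delta) (k delta)]) ->
     unbounded_at0 nstar ->
     phi delta (nstar delta) @[delta --> 0^'+] --> 0%E).
Proof.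
have [_ _ _ J1ge0] := hJ1; have [_ _ _ J2ge0] := hJ2.
have lam0 n : 0 <= lam n by exact: ltW.
have mu0 n : 0 <= mu n by exact: ltW.
have C1C : C1 <= C by rewrite le_max lexx.
have C2C : C2 <= C by rewrite le_max lexx orbT.
have C_ge1 : 1 <= C by exact: le_trans C1C.
set c := ((lam 0%N)%:E * J1 Ud + (mu 0%N)%:E * J2 Kd)%E.
have c0 : (0 <= c)%E by rewrite adde_ge0// mule_ge0// lee_fin.
have cfin : c \is a fin_num by rewrite fin_numD !fin_numM// ge0_fin_numE.
have rate delta (noise : L2 R) f u k : `|noise| <= delta ->
    f =1 convolution Kd Ud \+ Lspace_repr noise ->
    mhdm J1 J2 S1 S2 lam mu f u k ->
    forall n, (Phi S1 S2 (partial_sum k n) (partial_sum u n) f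
      <= 2%:E * c * (n.+1%:R^-1)%:E + (delta ^+ 2)%:E)%E.
  move=> noise_le fE umin; exact: (mhdm_rate _ J1 J2 S1 S2 lam mu Ud Kd noise C1 C2 C).
split.
  move=> delta noise f u k _ noise_le fE umin; split.
    apply: mhdm_decreasing umin => //.
      by rewrite ge0_fin_numE// (le_lt_trans (J1_min0 Ud)).
    by rewrite ge0_fin_numE// (le_lt_trans (J2_min0 Kd)).
  (* The rate holds with the factor 2; [1 <= C] weakens it to [2 * C]. *)
  move=> n; apply: le_trans (rate _ _ _ _ _ noise_le fE umin n) _.
  apply: leeD => //; apply: lee_wpmul2r => //.
  by apply: lee_wpmul2r => //; rewrite lee_fin ler_peMr.
move=> tau noise f u k phi nstar tau1 data _.
have tau_ge0 : 0 <= tau by rewrite ltW// (lt_trans ltr01).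
have phi_le delta : 0 < delta -> (phi delta (nstar delta) <= (tau * delta ^+ 2)%:E)%E.
  move=> delta0; have [noise_le fE umin] := data delta delta0.
  (* The gap between the threshold [tau * delta ^+ 2] and the noise level [delta ^+ 2], positive
     since [1 < tau]. From [N] on, [2 * c / (n + 1)] fits into it. *)
  pose b := (tau - 1) * delta ^+ 2.
  have b0 : 0 < b by rewrite mulr_gt0 ?subr_gt0// exprn_gt0.
  pose N := Num.bound (2 * fine c / b).
  apply: (stopping_index_le _ _ _ _ N) => n Nn.
  apply: le_trans (rate _ _ _ _ _ noise_le fE umin n) _.
  rewrite -(fineK cfin) -!EFinM -EFinD lee_fin -lerBrDr.
  rewrite (_ : _ - _ = b); last by rewrite /b mulrBl mul1r.
  rewrite ler_pdivrMr ?ltr0n// [leRHS]mulrC -ler_pdivrMr//.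
  apply: le_trans (ltW (archi_boundP _)) _.
    by apply: divr_ge0; [apply: mulr_ge0 => //; exact: fine_ge0|exact: ltW].
  by rewrite ler_nat; exact: leqW.
(* The value at the stopping index lies between 0 and [tau * delta ^+ 2], which tends to 0 by
   continuity. *)
apply: (@squeeze_cvge _ _ _ _ (fun=> 0%E) _ (fun delta => (tau * delta ^+ 2)%:E)).
- near=> delta; rewrite Phi_ge0 phi_le//.
- exact: cvg_cst.
- rewrite (_ : 0%E = (tau * 0 ^+ 2)%:E); last by rewrite expr0n/= mulr0.
  apply: cvg_EFin; first exact: nearW.
  apply: cvg_at_right_filter.
  by apply: cvgM; [exact: cvg_cst|exact: exprn_continuous].
Unshelve. all: by end_near.
Qed.
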